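(* Let $n,r\ge 1$, let $A\in\mathbb{R}^{n\times n}$ and $B\in\mathbb{R}^{n\times r}$ be arbitrary matrices, and for each $N$ let $P_N=[B,AB,\dots,A^{N-1}B]\in\mathbb{R}^{n\times rN}$, with $i$-th column denoted $p_i$ ($1\le i\le rN$). Then for every $N\ge 2$ the $n$-dimensional volume of the zonotope $E_n(P_N)$ generated by the pair $\{A,B\}$ satisfies $$V_n(E_n(P_N))=(1+|\det A|)\,V_n(E_n(P_{N-1}))-|\det A|\,V_n(E_n(P_{N-2}))+\sum_{j=1}^{r}\sum_{k=1}^{r}\ \sum_{(i_1,\dots,i_n)\in \Theta_{0,0}^{j}\times\Theta_{1,N-2}^{n-j-k}\times\Theta_{N-1,N-1}^{k}}\bigl|\det[p_{i_1},p_{i_2},\dots,p_{i_n}]\bigr| .$$ Moreover, for fixed $n$ and $r$, computing $V_n(E_n(P_N))$ recursively by this equation has computational complexity $\mathcal{O}(N^{n-1})$ in the variable $N$, where complexity is measured by the total number of $n\times n$ determinants evaluated.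
   Context: The zonotope generated by the matrix pair $\{A,B\}$ is $E_n(P_N)=\{\sum_{i=1}^{rN}c_ip_i : c_i\in[0,1],\ i=1,\dots,rN\}\subset\mathbb{R}^n$, and $V_n$ denotes $n$-dimensional volume (Lebesgue measure in $\mathbb{R}^n$, so it is $0$ when $P_N$ has rank less than $n$). For integers $a,b$ and $j\ge 0$, $\Theta_{a,b}^{j}$ is the set of all $j$-tuples $(i_1,\dots,i_j)$ with $i_1<i_2<\dots<i_j$ and all entries in $\{ra+1,ra+2,\dots,r(b+1)\}$ (i.e. the column indices of the blocks $A^aB,\dots,A^bB$ of the matrix $P_N$). The product $\Theta\times\Theta'$ of two such sets is the set of concatenated tuples. Conventions: $\Theta_{a,b}^{0}$ consists of the single empty tuple; $\Theta_{a,b}^{j}$ is empty if $j<0$ or if there are fewer than $j$ available indices (so terms with $n-j-k<0$ contribute $0$); $V_n(E_n(P_0))=0$. The recursive computation evaluates $V_n(E_n(P_1))$ as the sum of $|\det|$ over all $n$-element subsets of the columns of $B$, evaluates $\det A$ once, and then computes $V_n(E_n(P_M))$ for $M=2,\dots,N$ by the recursion, evaluating each determinant in the triple sum. *)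

(* Defs.v *)
From HB Require Import structures.
From mathcomp Require Import all_boot all_order all_algebra.
From mathcomp Require Import all_classical all_reals all_analysis.

Set Implicit Arguments.
Unset Strict Implicit.
Unset Printing Implicit Defensive.

Import Order.TTheory GRing.Theory Num.Theory.
Import numFieldNormedType.Exports.

Local Open Scope classical_set_scope.
Local Open Scope ring_scope.

Section ProductStep.
Variables (R : realType) (n : nat).
Local Notation T := (measurableTypeR R).
Variable mu : {sigma_finite_measure set (n.-tuple T) -> \bar R}.

Let cons_pair (p : T * n.-tuple T) : n.+1.-tuple T := cons_tuple p.1 p.2.

Let measurable_cons_pair : measurable_fun setT cons_pair.
Proof. exact: measurable_cons. Qed.

Let measurable_pre S : measurable S -> measurable (cons_pair @^-1` S).
Proof.
by move=> mS; rewrite -[X in measurable X]setTI; exact: measurable_cons_pair.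
Qed.

Let step : set (n.+1.-tuple T) -> \bar R :=
  pushforward (@lebesgue_measure R \x mu)%E cons_pair.

Let step0 : step set0 = 0%E.
Proof. by rewrite /step /pushforward preimage_set0 measure0. Qed.

Let step_ge0 S : (0 <= step S)%E.
Proof. exact: measure_ge0. Qed.

Let step_sigma_additive : semi_sigma_additive step.
Proof.
move=> F mF tF mUF; rewrite /step /pushforward preimage_bigcup.
apply: measure_semi_sigma_additive.
- by move=> i; exact: measurable_pre.
- apply/trivIsetP => /= i j _ _ ij; rewrite -preimage_setI.
  by move/trivIsetP : tF => /(_ _ _ _ _ ij) ->//; rewrite preimage_set0.
- by rewrite -preimage_bigcup; exact: measurable_pre.
Qed.

HB.instance Definition _ :=
  isMeasure.Build _ _ _ step step0 step_ge0 step_sigma_additive.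

Let split_tuple (t : n.+1.-tuple T) : T * n.-tuple T :=
  (thead t, [tuple of behead t]).

Let measurable_split : measurable_fun setT split_tuple.
Proof.
apply/measurable_fun_pairP; split.
  exact: (measurable_tnth (T := T) ord0).
exact: measurable_behead.
Qed.

Let split_cons p : split_tuple (cons_pair p) = p.
Proof. by case: p => x t; rewrite /split_tuple/=; congr pair; apply: val_inj. Qed.

Let step_sigma_finite : sigma_finite setT step.
Proof.
have /sigma_finiteP[F [FT ndF Foo]] := sigma_finiteT (@lebesgue_measure R).
have /sigma_finiteP[G [GT ndG Goo]] := sigma_finiteT mu.
exists (fun k => split_tuple @^-1` (F k `*` G k)).
  rewrite -preimage_bigcup (_ : \bigcup_k _ = setT) ?preimage_setT//.
  apply/seteqP; split => // -[x t] _.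
  have [i _ Fi] : (\bigcup_k F k) x by rewrite -FT.
  have [j _ Gj] : (\bigcup_k G k) t by rewrite -GT.
  exists (maxn i j) => //; split => /=.
    by move: x Fi; exact/subsetPset/ndF/leq_maxl.
  by move: t Gj; exact/subsetPset/ndG/leq_maxr.
move=> k; have [mF Fk] := Foo k; have [mG Gk] := Goo k; split.
  rewrite -[X in measurable X]setTI.
  by apply: measurable_split => //; exact: measurableX.
rewrite /step /pushforward (_ : _ @^-1` _ = F k `*` G k); last first.
  have pre U : cons_pair @^-1` (split_tuple @^-1` U) = U.
    by rewrite -comp_preimage; apply/seteqP; split => p; rewrite /preimage/= split_cons.
  exact: pre.
by rewrite product_measure1E// lte_mul_pinfty// ge0_fin_numE.
Qed.

HB.instance Definition _ :=
  Measure_isSigmaFinite.Build _ _ _ step step_sigma_finite.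

Definition product_step : {sigma_finite_measure set (n.+1.-tuple T) -> \bar R} :=
  step.

Lemma product_stepE S :
  product_step S =
  (@lebesgue_measure R \x mu)%E [set p | S (cons_tuple p.1 p.2)].
Proof. by []. Qed.

End ProductStep.

Section LebesgueMeasure.
Variable R : realType.
Local Notation T := (measurableTypeR R).

(* Lebesgue measure on the Borel sets of R^n, as an iterated product of the
   one-dimensional one; lebesgue_tuple_box gives its value on boxes. *)
Fixpoint lebesgue_tuple (n : nat) :
    {sigma_finite_measure set (n.-tuple T) -> \bar R} :=
  match n with
  | 0 => dirac ([tuple] : 0.-tuple T)
  | m.+1 => product_step (lebesgue_tuple m)
  end.

Lemma lebesgue_tuple_box n (a b : 'I_n -> R) : (forall i, a i <= b i) ->
  lebesgue_tuple n [set t | forall i, a i <= tnth t i <= b i] =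
  (\prod_(i < n) (b i - a i))%:E.
Proof.
elim: n a b => [|n IHn] a b ab /=.
  rewrite big_ord0 diracE mem_set//; by case.
rewrite big_ord_recl EFinM product_stepE.
rewrite (_ : [set p | _] = `[a ord0, b ord0]%classic `*`
  [set t : n.-tuple T | forall i, a (lift ord0 i) <= tnth t i <= b (lift ord0 i)]); last first.
  apply/seteqP; split => -[x t] /=.
    move=> H; split; first by rewrite in_itv/=; exact: (H ord0).
    by move=> i; have := H (lift ord0 i); rewrite tnthS.
  rewrite in_itv/= => -[H0 H] i.
  by case: (unliftP ord0 i) => [j ->|->//]; rewrite tnthS.
have mbox : measurable [set t : n.-tuple T |
    forall i, a (lift ord0 i) <= tnth t i <= b (lift ord0 i)].
  rewrite (_ : mkset _ = \bigcap_(i in [set: 'I_n])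
    ((fun t : n.-tuple T => tnth t i) @^-1` `[a (lift ord0 i), b (lift ord0 i)]%classic)); last first.
    apply/seteqP; split => t /= H i; first by move=> _; rewrite /= in_itv/=.
    by have := H i Logic.I; rewrite /= in_itv.
  apply: fin_bigcap_measurable; first exact: finite_finset.
  move=> i _; rewrite -[X in measurable X]setTI.
  exact: (measurable_tnth (T := T) i).
have mi : measurable (`[a ord0, b ord0]%classic : set T) by exact: measurable_itv.
rewrite [LHS]product_measure1E//.
rewrite IHn//; congr (_ * _)%E.
apply: etrans (lebesgue_measure_itv _) _; rewrite /= lte_fin; case: ltP => // ba.
have -> : b ord0 = a ord0 by apply/le_anti; rewrite ba ab.
by rewrite subrr.
Qed.

Definition volume n (E : set 'cV[R]_n) : \bar R :=
  lebesgue_tuple n [set t | E (\col_i tnth t i)].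

End LebesgueMeasure.

Section IndexTuples.
Local Open Scope nat_scope.

(* Columns of the reachability matrix are numbered from 1, so the blocks
   A^a B, ..., A^b B occupy the columns r a + 1, ..., r (b + 1).  The length is
   an integer because n - j - k may be negative. *)
Definition Theta (r a b : nat) (j : int) : seq (seq nat) :=
  if j is Posz l then
    [seq s <- [seq map val t | t : l.-tuple 'I_(r * b.+1).+1]
       | sorted ltn s & all (fun i => r * a + 1 <= i) s]
  else [::].

Lemma mem_Theta (r a b : nat) (j : int) (s : seq nat) :
  (s \in Theta r a b j) =
  [&& j == (size s)%:Z, sorted ltn s
    & all (fun i => r * a + 1 <= i <= r * b.+1) s].
Proof.
case: j => [l|//]; rewrite /= eqz_nat all_predI mem_filter -!andbA.
have -> : (s \in [seq map val t | t : l.-tuple 'I_(r * b.+1).+1]) =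
          (l == size s) && all (fun i => i <= r * b.+1) s.
  apply/mapP/andP => [[t _ ->]|[/eqP ls sb]].
    rewrite size_map size_tuple; split => //.
    by apply/allP => _ /mapP[i _ ->]; rewrite -ltnS; exact: ltn_ord.
  have st : size (map (@inord (r * b.+1)) s) == l by rewrite size_map ls.
  exists (Tuple st); rewrite ?mem_enum//= -map_comp map_id_in// => i si /=.
  by rewrite inordK// ltnS; exact: (allP sb).
by case: (sorted _ _); case: (all _ _); case: (_ == _); case: (all _ _).
Qed.

Lemma Theta_uniq r a b j : uniq (Theta r a b j).
Proof.
case: j => [l|//]; apply: filter_uniq; rewrite map_inj_uniq ?enum_uniq// => t t'.
by move=> /(inj_map val_inj)/val_inj.
Qed.

Definition catprod (S S' : seq (seq nat)) : seq (seq nat) :=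
  [seq s ++ s' | s <- S, s' <- S'].

End IndexTuples.

Section Zonotope.
Variables (R : realType) (n : nat).

Definition zonotope m (P : 'M[R]_(n, m)) : set 'cV[R]_n :=
  [set x | exists c : 'I_m -> R,
    (forall i, 0 <= c i <= 1) /\ x = \sum_(i < m) c i *: col i P].

Variable r : nat.
Implicit Types (A : 'M[R]_n) (B : 'M[R]_(n, r)).

Definition reach_mx A B (N : nat) : 'M[R]_(n, \sum_(k < N) r) :=
  \mxrow_(k < N) (A ^+ k *m B).

(* The i-th column, counting from 1; meaningful for 1 <= i <= r N only. *)
Definition reach_col A B N (i : nat) : 'cV[R]_n :=
  if insub i.-1 is Some l then col l (reach_mx A B N) else 0.

Definition cols_mx A B N (s : seq nat) : 'M[R]_n :=
  \matrix_(x < n, l < n) reach_col A B N (nth 0%N s l) x ord0.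

Lemma reach_col_block A B (N : nat) (a : 'I_N) (c : 'I_r) :
  reach_col A B N (r * a + c.+1) = col c (A ^+ a *m B).
Proof.
have ac : tagnat.Rank (p_ := fun _ : 'I_N => r) a c = (r * a + c)%N :> nat.
  rewrite tagnat.RankEsum; congr addn.
  by rewrite -(big_ord_widen N (fun=> r) (ltnW (ltn_ord a))) sum_nat_const card_ord mulnC.
rewrite /reach_col addnS/= -ac valK.
rewrite -(mxrowK (fun k : 'I_N => A ^+ k *m B) a).
by apply/matrixP => x y; rewrite !mxE.
Qed.

End Zonotope.

(* A value together with the number of determinants evaluated to obtain it. *)
Definition counted (X : Type) : Type := (X * nat)%type.

Definition cret X (x : X) : counted X := (x, 0%N).

Definition cbind X Y (m : counted X) (f : X -> counted Y) : counted Y :=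
  ((f m.1).1, (m.2 + (f m.1).2)%N).

(* Sequencing adds the numbers of determinants of the two steps. *)
Local Notation "x <~ m ;; e" := (cbind m (fun x => e))
  (at level 61, m at next level, right associativity).

Section RecursiveComputation.
Variables (R : realType) (n r : nat).
Implicit Types (A : 'M[R]_n) (B : 'M[R]_(n, r)).

(* The only operation that is charged. *)
Definition cdet (M : 'M[R]_n) : counted R := (\det M, 1%N).

Fixpoint csum X (f : X -> counted R) (s : seq X) : counted R :=
  if s is x :: s' then v <~ f x ;; w <~ csum f s' ;; cret (v + w) else cret 0.

Definition csum_absdet A B N (S : seq (seq nat)) : counted R :=
  csum (fun s => d <~ cdet (cols_mx A B N s) ;; cret `|d|) S.

Definition csum_mixed A B N : counted R :=
  csum (fun j : nat => csum (fun k : nat =>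
      csum_absdet A B N
        (catprod (catprod (Theta r 0 0 j)
                          (Theta r 1 (N - 2) (n%:Z - j%:Z - k%:Z)))
                 (Theta r (N - 1) (N - 1) k)))
    (iota 1 r)) (iota 1 r).

(* Computes the volumes for P_(m+1) and P_m, where v1 is the volume for P_1 and
   d is the determinant of A; the volume for P_0 is 0. *)
Fixpoint crec A B (v1 d : R) (m : nat) : counted (R * R) :=
  if m is m'.+1 then
    v <~ crec A B v1 d m' ;;
    t <~ csum_mixed A B m.+1 ;;
    cret ((1 + `|d|) * v.1 - `|d| * v.2 + t, v.1)
  else cret (v1, 0).

Definition cvolume A B (N : nat) : counted R :=
  v1 <~ csum_absdet A B 1 (Theta r 0 0 n) ;;
  d <~ cdet A ;;
  v <~ crec A B v1 d N.-1 ;;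
  cret v.1.

End RecursiveComputation.

(* Main.v *)
(* The volume of a zonotope with generators p_1, ..., p_m is the sum of
   |det [p_i : i in I]| over the n-element sets I of indices; the recursion is
   then inclusion-exclusion on the first and last blocks of columns of P_N,
   since multiplying every column by A multiplies the sum by |det A|.

   The volume formula goes by induction on m, in all dimensions at once.
   Shears and scalings reduce to p_1 = e_1.  Over a point y of the projection
   along e_1 the fibre of Z + [0,1] e_1 is a segment one unit longer than the
   fibre of Z, and over the other points both are empty, so Fubini gives
   V_n(Z + [0,1] e_1) = V_n(Z) + V_{n-1}(projection of Z).  The sum of minors
   obeys the same rule, by expanding those that involve e_1.  Zonotopes are
   measurable because Fourier-Motzkin elimination makes them finite
   intersections of half-spaces.

   With j, k >= 1 the triple sum for P_M has O(M^(n-2)) terms, and no term at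
   all if n = 1; summing over M <= N gives O(N^(n-1)). *)

Require Import Defs.
From mathcomp Require Import all_boot all_order all_algebra.
From mathcomp Require Import all_classical all_reals all_analysis.
From mathcomp Require Import measurable_realfun ring lra zify.
Import Order.TTheory GRing.Theory Num.Theory.
Local Open Scope ring_scope.

Set Implicit Arguments.
Unset Strict Implicit.
Unset Printing Implicit Defensive.

(** * Fubini for the iterated Lebesgue measure *)

Section Volume.
Local Open Scope classical_set_scope.
Local Open Scope ring_scope.
Variable R : realType.
Local Notation T := (measurableTypeR R).
Local Notation leb := (@lebesgue_measure R).

(** The right side, as a function of [F], is a measure that agrees with Lebesgue measure on
    half-open intervals, and those values determine it. *)
Lemma lebesgue_measure_affine (k b : R) (F : set T) : k != 0 -> measurable F ->
  leb F = (`|k|%:E * leb [set x | F (k * x + b)%R])%E.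
Proof.
move=> k0 mF; pose f := (fun x => k * x + b) : T -> T.
have mf : measurable_fun setT f.
  by apply: measurable_funD => //; exact: measurable_funM.
have k_ge0 : 0 <= `|k| by [].
pose mu := mscale (NngNum k_ge0)
  (measure_function_pushforward__canonical__measure_function_Measure leb mf).
suff H : forall X, ocitv X -> leb X = mu X by exact: (lebesgue_measure_unique (mu := mu)).
move=> _ [[u v] _ <-]; rewrite /mu /mscale /pushforward /=.
rewrite (lebesgue_measure_itv `]u, v]) /= lte_fin.
have [k_lt0|k_gt0|/eqP] := ltrgtP k 0; last by rewrite (negbTE k0).
(* A negative [k] reverses the interval, so its closed end becomes the left one. *)
- rewrite [RHS](_ : _ = `|k|%:E * leb `[((v - b) / k)%R, ((u - b) / k)%R[%classic)%E; last first.
    congr (_ * lebesgue_measure _)%E; apply/seteqP.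
    by split => x /=; rewrite !in_itv/= /f ler_ndivrMr// ltr_ndivlMr//; lra.
  rewrite lebesgue_measure_itv /= lte_fin ltr_ndivrMr// divfK//.
  rewrite (_ : (u - b < v - b) = (u < v)); last by apply/idP/idP; lra.
  case: ifP => uv; last by rewrite mule0.
  by rewrite ltr0_norm//= -EFinB -!EFinM; congr EFin; field.
- rewrite [RHS](_ : _ = `|k|%:E * leb `]((u - b) / k)%R, ((v - b) / k)%R]%classic)%E; last first.
    congr (_ * lebesgue_measure _)%E; apply/seteqP.
    by split => x /=; rewrite !in_itv/= /f ler_pdivlMr// ltr_pdivrMr//; lra.
  rewrite lebesgue_measure_itv /= lte_fin ltr_pdivrMr// divfK//.
  rewrite (_ : (u - b < v - b) = (u < v)); last by apply/idP/idP; lra.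
  case: ifP => uv; last by rewrite mule0.
  by rewrite gtr0_norm//= -EFinB -!EFinM; congr EFin; field.
Qed.

(** Measurability is asked on tuples because [volume] measures a set of columns through its
    coordinate tuples. *)
Definition col_measurable n (E : set 'cV[R]_n) :=
  measurable [set t : n.-tuple T | E (\col_i tnth t i)].

(** [G] may be rectangular, which also covers slices at a fixed first coordinate. *)
Lemma col_measurable_affine m n (G : 'M[R]_(n, m)) (b : 'cV[R]_n) (E : set 'cV[R]_n) :
  col_measurable E -> col_measurable [set y | E (G *m y + b)].
Proof.
pose f (t : m.-tuple T) : n.-tuple T := [tuple (G *m (\col_i tnth t i) + b) i 0 | i < n].
have mf : measurable_fun setT f.
  apply/measurable_fun_tnthP => i.
  rewrite (_ : _ \o _ = (fun t : m.-tuple T => \sum_(j < m) G i j * tnth t j + b i 0)).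
    apply: measurable_funD => //; apply: measurable_sum => j.
    by apply: measurable_funM => //; exact: measurable_tnth.
  apply/funext => t /=; rewrite tnth_mktuple !mxE; congr (_ + _).
  by apply: eq_bigr => j _; rewrite mxE.
move=> mE; rewrite /col_measurable (_ : mkset _ = f @^-1` [set t | E (\col_i tnth t i)]).
  by rewrite -[X in measurable X]setTI; exact: mf.
have fE t : G *m (\col_i tnth t i) + b = \col_i tnth (f t) i.
  by apply/matrixP => i j; rewrite ord1 [RHS]mxE tnth_mktuple.
by apply/seteqP; split => t /=; rewrite fE.
Qed.

Lemma col_cons n (x : T) (t : n.-tuple T) :
  \col_i tnth (cons_tuple x t) i = col_mx x%:M (\col_i tnth t i) :> 'cV[R]_n.+1.
Proof.
apply/matrixP => i j; rewrite ord1 mxE.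
case: (unliftP ord0 i) => [k ->|->].
  rewrite tnthS; have -> : lift ord0 k = rshift 1 k by apply: val_inj.
  by rewrite (@col_mxEd _ 1 n 1) mxE.
have -> : ord0 = lshift n ord0 :> 'I_(1 + n) by apply: val_inj.
by rewrite (@col_mxEu _ 1 n 1) mxE.
Qed.

Lemma measurable_cons_pre n (E : set 'cV[R]_n.+1) : col_measurable E ->
  measurable [set p : T * n.-tuple T | E (col_mx p.1%:M (\col_i tnth p.2 i))].
Proof.
move=> mE; have -> : [set p : T * n.-tuple T | E (col_mx p.1%:M (\col_i tnth p.2 i))] =
  (fun p => cons_tuple p.1 p.2) @^-1` [set t | E (\col_i tnth t i)].
  by apply/seteqP; split => -[x t] /=; rewrite col_cons.
have mc : measurable_fun setT (fun p : T * n.-tuple T => [the n.+1.-tuple T of p.1 :: p.2]).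
  exact: measurable_cons.
by rewrite -[X in measurable X]setTI; exact: mc.
Qed.

(** Integration over slices at a fixed first coordinate is the defining order of the product
    measure. *)
Lemma volumeS n (E : set 'cV[R]_n.+1) :
  volume E = (\int[leb]_x volume [set y : 'cV_n | E (col_mx x%:M y)])%E.
Proof.
rewrite {1}/volume [LHS]/= product_stepE; apply: eq_integral => x _ /=.
rewrite /volume; congr (lebesgue_tuple _ _ _); apply/seteqP.
by split => t; rewrite /xsection /= inE /= col_cons.
Qed.

(** Tonelli for the indicator of [E] gives the other order, with lengths of fibres along the first
    axis inside. *)
Lemma volumeS_fiber n (E : set 'cV[R]_n.+1) : col_measurable E ->
  volume E = (\int[lebesgue_tuple R n]_t
    leb [set x | E (col_mx x%:M (\col_i tnth t i))])%E.
Proof.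
move=> mE; have := measurable_cons_pre mE; set A := mkset _ => mA.
rewrite /volume [LHS]/= product_stepE.
have -> : [set p | [set t | E (\col_i tnth t i)] (cons_tuple p.1 p.2)] = A.
  by apply/seteqP; split => -[x t] /=; rewrite col_cons.
have := indic_fubini_tonelli leb (lebesgue_tuple R n) mA.
rewrite indic_fubini_tonelli_FE// indic_fubini_tonelli_GE// => H.
apply: etrans (etrans H _) => //; apply: eq_integral => t _ /=.
by congr (lebesgue_measure _); apply/seteqP; split => x; rewrite /ysection /= inE.
Qed.

Lemma measurable_fiber n (E : set 'cV[R]_n.+1) (y : 'cV[R]_n) : col_measurable E ->
  measurable ([set x | E (col_mx x%:M y)] : set T).
Proof.
move=> /measurable_cons_pre mE; have := measurable_ysection [tuple y i 0 | i < n] mE.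
have yE : \col_i tnth [tuple y i0 0 | i0 < n] i = y.
  by apply/matrixP => i j; rewrite mxE tnth_mktuple ord1.
by congr measurable; apply/seteqP; split => x; rewrite /ysection /= inE /= yE.
Qed.

Lemma measurable_fun_fiber n (E : set 'cV[R]_n.+1) : col_measurable E ->
  measurable_fun setT (fun t : n.-tuple T => leb [set x | E (col_mx x%:M (\col_i tnth t i))]).
Proof.
move=> /measurable_cons_pre mE; have := measurable_fun_ysection leb mE.
congr measurable_fun; apply/funext => t /=.
by congr (lebesgue_measure _); apply/seteqP; split => x; rewrite /ysection /= inE.
Qed.

Lemma volume_translate n (b : 'cV[R]_n) (E : set 'cV[R]_n) : col_measurable E ->
  volume [set y | E (y + b)] = volume E.
Proof.
elim: n => [|n IHn] in b E *.
  by move=> _; congr volume; apply/seteqP; split => y /=; rewrite [y + b]flatmx0 [y]flatmx0.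
move=> mE; pose b0 := b ord0 ord0; pose b' := dsubmx (b : 'cV_(1 + n)).
have bE : b = col_mx b0%:M b' :> 'cV_(1+n).
  rewrite -[LHS](@vsubmxK _ 1 n 1); congr col_mx; apply/matrixP => i j.
  by rewrite !ord1 !mxE mulr1n; congr (b _ _); apply: val_inj.
have mE' : col_measurable [set y | E (y + b)].
  have := col_measurable_affine 1%:M b mE; congr col_measurable.
  by apply/seteqP; split => y /=; rewrite mul1mx.
(* The translation by [b] is split in two: fibres along the first axis absorb [b0], and slices
   absorb [b'] by induction. *)
rewrite [LHS]volumeS_fiber// (_ : volume E = volume [set y | E (y + col_mx 0 b' : 'cV_(1+n))]).
  rewrite volumeS_fiber; last first.
    have := col_measurable_affine 1%:M (col_mx 0 b' : 'cV_(1+n)) mE; congr col_measurable.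
    by apply/seteqP; split => y /=; rewrite mul1mx.
  apply: eq_integral => t _.
  rewrite [RHS](@lebesgue_measure_affine 1 b0) ?oner_eq0//; last first.
    have mF := measurable_fiber (\col_i tnth t i + b') mE.
    move: mF; congr measurable; apply/seteqP.
    by split => x /=; rewrite (@add_col_mx _ 1 n 1) addr0.
  rewrite normr1 mul1e; congr (lebesgue_measure _); apply/seteqP.
  by split => x /=; rewrite bE !(@add_col_mx _ 1 n 1) mul1r addr0 raddfD.
rewrite !volumeS; apply: eq_integral => x _.
rewrite -[LHS](IHn b').
  congr volume; apply/seteqP.
  by split => y /=; rewrite !(@add_col_mx _ 1 n 1) addr0.
have := col_measurable_affine (col_mx 0 1%:M : 'M[R]_(1 + n, n)) (col_mx x%:M 0) mE.
congr col_measurable; apply/seteqP.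
by split => y /=; rewrite mul_col_mx mul0mx mul1mx (@add_col_mx _ 1 n 1) add0r addr0.
Qed.

End Volume.

(** * Linear changes of variables *)

Section LinearMaps.
Local Open Scope classical_set_scope.
Local Open Scope ring_scope.
Variable R : realType.

(** Change of variables in terms of preimages. It is established for shears, scalings and their
    products, which suffice to move a nonzero vector to the first basis vector. *)
Definition scales_volume n (G : 'M[R]_n) := G \in unitmx /\
  forall E, col_measurable E ->
    volume E = (`|\det G|%:E * volume [set x | E (G *m x)])%E.

Lemma col_measurable_linear m n (G : 'M[R]_(n, m)) (E : set 'cV[R]_n) :
  col_measurable E -> col_measurable [set y | E (G *m y)].
Proof.
move=> /(col_measurable_affine G 0); congr col_measurable.
by apply/seteqP; split => y /=; rewrite addr0.
Qed.

Lemma scales_volumeM n (G H : 'M[R]_n) :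
  scales_volume G -> scales_volume H -> scales_volume (G *m H).
Proof.
move=> [uG GE] [uH HE]; split; first by rewrite unitmx_mul uG uH.
move=> E mE; rewrite GE// HE; last exact: col_measurable_linear.
rewrite muleA -EFinM -normrM -det_mulmx; congr (_ * volume _)%E.
by apply/seteqP; split => x /=; rewrite mulmxA.
Qed.

(** Only the first coordinate changes, so on each fibre along the first axis the map is affine with
    slope [k]. *)
Lemma scales_volume_row n (k : R) (c : 'rV[R]_n) : k != 0 ->
  scales_volume (block_mx k%:M c 0 1%:M : 'M[R]_(1 + n)).
Proof.
move=> k0.
have detG : \det (block_mx k%:M c 0 1%:M : 'M[R]_(1 + n)) = k.
  by rewrite det_ublock det1 mulr1 det_scalar1.
split; first by rewrite unitmxE detG unitfE.
move=> E mE; rewrite detG !volumeS_fiber//; last exact: col_measurable_linear.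
rewrite -ge0_integralZl_EFin//; last first.
  by apply: measurable_fun_fiber; exact: col_measurable_linear.
apply: eq_integral => t _.
rewrite (@lebesgue_measure_affine _ k ((c *m (\col_i tnth t i)) 0 0))//; last first.
  exact: measurable_fiber.
congr (_ * lebesgue_measure _)%E; apply/seteqP.
have xE x : (k * x + (c *m (\col_i tnth t i)) 0 0)%:M = k%:M *m x%:M + c *m (\col_i tnth t i).
  by rewrite -scalar_mxM raddfD/= -mx11_scalar.
by split => x /=; rewrite (@mul_block_col _ 1 n 1 n 1) mul0mx add0r mul1mx xE.
Qed.

(** The first coordinate x is kept, and the slice over it is translated by x times [d]. *)
Lemma scales_volume_col n (d : 'cV[R]_n) :
  scales_volume (block_mx 1%:M 0 d 1%:M : 'M[R]_(1 + n)).
Proof.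
have detG : \det (block_mx 1%:M 0 d 1%:M : 'M[R]_(1 + n)) = 1.
  by rewrite det_lblock !det1 mulr1.
split; first by rewrite unitmxE detG unitr1.
move=> E mE; rewrite detG normr1 mul1e !volumeS; apply: eq_integral => x _.
rewrite -(volume_translate (d *m x%:M)).
  congr volume; apply/seteqP.
  by split => y /=; rewrite (@mul_block_col _ 1 n 1 n 1) mul0mx addr0 !mul1mx addrC.
have := col_measurable_affine (col_mx 0 1%:M : 'M[R]_(1 + n, n)) (col_mx x%:M 0) mE.
congr col_measurable; apply/seteqP.
by split => y /=; rewrite mul_col_mx mul0mx mul1mx (@add_col_mx _ 1 n 1) add0r addr0.
Qed.

(** A row operation turns the first entry into 1; a shear then clears the entries below it. *)
Lemma scales_volume_to_e0 n (p : 'cV[R]_(1 + n)) : p != 0 ->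
  exists2 G, scales_volume G & G *m p = col_mx 1%:M 0.
Proof.
rewrite -(vsubmxK p); move: (usubmx p) (dsubmx p) => p0 q pn0.
(* A nonzero first entry is divided by itself; a zero one receives a multiple of a nonzero entry of
   [q]. *)
have [k [c [k0 kc]]] : exists k (c : 'rV_n), k != 0 /\ k%:M *m p0 + c *m q = 1%:M.
  have [p00|p0n0] := eqVneq (p0 0 0) 0; last first.
    exists (p0 0 0)^-1, 0; rewrite invr_eq0 p0n0 mul0mx addr0; split => //.
    by rewrite {2}[p0]mx11_scalar -scalar_mxM mulVf.
  have [i qi] : exists i, q i 0 != 0.
    apply: contrapT => q0; case/negP: pn0.
    apply/eqP; rewrite [p0]mx11_scalar p00 raddf0 (_ : q = 0) ?col_mx0//.
    by apply/matrixP => i j; rewrite ord1 mxE; apply: contrapT => /eqP qi; apply: q0; exists i.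
  exists 1, ((q i 0)^-1 *: delta_mx 0 i); split; first exact: oner_neq0.
  rewrite mul1mx [p0]mx11_scalar p00 raddf0 add0r -scalemxAl -rowE.
  by apply/matrixP => a b; rewrite !ord1 !mxE mulVf.
exists (block_mx 1%:M 0 (- q) 1%:M *m block_mx k%:M c 0 1%:M).
  by apply: scales_volumeM; [exact: scales_volume_col|exact: scales_volume_row].
rewrite -mulmxA !mul_block_col kc !mul0mx !mul1mx add0r addr0 mulmx1.
by rewrite addNr.
Qed.

End LinearMaps.

(** * Zonotopes as intersections of half-spaces *)

Section ZonotopeMeasurable.
Local Open Scope classical_set_scope.
Local Open Scope ring_scope.
Variable R : realType.
Local Notation T := (measurableTypeR R).
Local Notation leb := (@lebesgue_measure R).

(** The Minkowski sum of the segments from 0 to each generator, peeled off one at a time so that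
    proofs can go by induction on the list. *)
Fixpoint seq_zonotope n (s : seq 'cV[R]_n) : set 'cV[R]_n :=
  if s is p :: s' then
    [set x | exists2 c : R, 0 <= c <= 1 & seq_zonotope s' (x - c *: p)]
  else [set 0].

Lemma seq_max (X : eqType) (f : X -> R) (s : seq X) : s != [::] ->
  exists2 m, m \in s & forall x, x \in s -> f x <= f m.
Proof.
elim: s => // a [|b s] IHs _.
  by exists a; rewrite ?mem_head// => x; rewrite inE => /eqP ->.
have [//|m ms mP] := IHs; have [am|ma] := leP (f a) (f m).
  exists m; first by rewrite inE ms orbT.
  by move=> x; rewrite inE => /orP[/eqP ->|/mP].
exists a; first exact: mem_head.
move=> x; rewrite inE => /orP[/eqP -> //|/mP xm].
exact: le_trans xm (ltW ma).
Qed.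

(** A pair (a, b) stands for a c <= b: it bounds c above by b / a if a > 0 and below if a < 0. A
    solution exists when no lower bound exceeds an upper bound. *)
Lemma fourier_motzkin1 (s : seq (R * R)) :
  (exists c, forall q, q \in s -> q.1 * c <= q.2) <->
  (forall q, q \in s -> q.1 = 0 -> 0 <= q.2) /\
  (forall q q', q \in s -> q' \in s -> 0 < q.1 -> q'.1 < 0 -> q'.1 * q.2 <= q.1 * q'.2).
Proof.
split=> [[c cP]|[s0 sP]].
  split=> [q /cP + q0|q q' /cP h /cP h' q0 q'0]; first by rewrite q0 mul0r.
  nra.
pose U := [seq q <- s | 0 < q.1]; pose L := [seq q <- s | q.1 < 0].
suff [c [cU cL]] : exists c, (forall q, q \in U -> c <= q.2 / q.1) /\
    (forall q, q \in L -> q.2 / q.1 <= c).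
  exists c => q qs; have [q0|q0|q0] := ltrgtP q.1 0.
  - have := cL q; rewrite mem_filter q0 qs => /(_ isT).
    by rewrite ler_ndivrMr// mulrC.
  - have := cU q; rewrite mem_filter q0 qs => /(_ isT).
    by rewrite ler_pdivlMr// mulrC.
  - by rewrite q0 mul0r; exact: s0.
(* The witness is the largest lower bound, or the smallest upper bound if there is no lower one, or
   0 if there is neither. *)
have [L0|/(seq_max (fun q => q.2 / q.1))[m mL mP]] := eqVneq L [::].
  have [U0|/(seq_max (fun q => - (q.2 / q.1)))[m mU mP]] := eqVneq U [::].
    by exists 0; rewrite L0 U0.
  exists (m.2 / m.1); split=> q; last by rewrite L0.
  by move=> /mP; rewrite lerN2.
exists (m.2 / m.1); split=> [q qU|]; last exact: mP.
move: qU mL; rewrite !mem_filter => /andP[q0 qs] /andP[m0 ms].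
rewrite ler_ndivrMr// mulrAC ler_pdivrMr//.
by have := sP _ _ qs ms q0 m0; lra.
Qed.

Definition halfspaces n (h : seq ('rV[R]_n * R)) : set 'cV[R]_n :=
  [set x | forall q, q \in h -> (q.1 *m x) 0 0 <= q.2].

Lemma halfspaces_measurable n (h : seq ('rV[R]_n * R)) : col_measurable (halfspaces h).
Proof.
rewrite /col_measurable (_ : mkset _ = \bigcap_(q in [set` h])
    [set t : n.-tuple T | (q.1 *m (\col_i tnth t i)) 0 0 <= q.2]); last first.
  by apply/seteqP; split => t.
apply: fin_bigcap_measurable; first exact: finite_seq.
move=> -[u a] _ /=.
have mf : measurable_fun setT (fun t : n.-tuple T => \sum_(i < n) u 0 i * tnth t i).
  apply: measurable_sum => i; apply: measurable_funM => //; exact: measurable_tnth.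
rewrite (_ : mkset _ = (fun t : n.-tuple T => \sum_(i < n) u 0 i * tnth t i) @^-1` `]-oo, a]%classic).
  by rewrite -[X in measurable X]setTI; apply: mf => //; exact: measurable_itv.
have uE (t : n.-tuple T) : (u *m (\col_i tnth t i)) 0 0 = \sum_(i < n) u 0 i * tnth t i.
  by rewrite mxE; apply: eq_bigr => i _; rewrite mxE.
by apply/seteqP; split => t /=; rewrite in_itv/= uE.
Qed.

Lemma mulmxBl00 n (a b : R) (u v : 'rV[R]_n) (x : 'cV[R]_n) :
  ((a *: u - b *: v) *m x) 0 0 = a * (u *m x) 0 0 - b * (v *m x) 0 0.
Proof.
rewrite mulmxBl -!scalemxAl; move: (u *m x) (v *m x) => y z.
by rewrite !mxE.
Qed.

Lemma mulmxBr00 n (c : R) (u : 'rV[R]_n) (x p : 'cV[R]_n) :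
  (u *m (x - c *: p)) 0 0 = (u *m x) 0 0 - c * (u *m p) 0 0.
Proof.
rewrite mulmxBr -scalemxAr; move: (u *m x) (u *m p) => y z.
by rewrite !mxE.
Qed.

(* A triple (a, u, alpha) stands for the constraint a c + u x <= alpha on (c, x);
   c is the variable eliminated. *)
Definition eliminate n (h : seq (R * 'rV[R]_n * R)) : seq ('rV[R]_n * R) :=
  [seq (q.1.2, q.2) | q <- h & q.1.1 == 0] ++
  [seq (q.1.1 *: q'.1.2 - q'.1.1 *: q.1.2, q.1.1 * q'.2 - q'.1.1 * q.2)
     | q <- [seq q <- h | 0 < q.1.1], q' <- [seq q <- h | q.1.1 < 0]].

(** For fixed [x] each triple is a constraint a c <= alpha - u x in one variable, to which
    [fourier_motzkin1] applies. *)
Lemma eliminateP n (h : seq (R * 'rV[R]_n * R)) (x : 'cV[R]_n) :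
  (exists c, forall q, q \in h -> q.1.1 * c + (q.1.2 *m x) 0 0 <= q.2) <->
  halfspaces (eliminate h) x.
Proof.
pose g (q : R * 'rV[R]_n * R) := (q.1.1, q.2 - (q.1.2 *m x) 0 0).
transitivity (exists c, forall q, q \in [seq g q | q <- h] -> q.1 * c <= q.2).
  split=> -[c cP]; exists c => q.
    by move=> /mapP[q' q'h ->] /=; have := cP _ q'h; lra.
  by move=> /(map_f g) /cP /=; lra.
apply: iff_trans (fourier_motzkin1 _) _; split.
  move=> [h0 hP] q; rewrite mem_cat => /orP[/mapP[q']|/allpairsP[[q1 q2]]].
    rewrite mem_filter => /andP[/eqP q0 q'h] -> /=.
    by have := h0 _ (map_f g q'h) q0; rewrite /=; lra.
  rewrite !mem_filter => -[/andP[q10 q1h] /andP[q20 q2h] ->] /=.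
  have := hP _ _ (map_f g q1h) (map_f g q2h) q10 q20.
  by rewrite mulmxBl00 /=; lra.
move=> hP; split.
  move=> _ /mapP[q qh ->] /= q0; rewrite subr_ge0.
  apply: (hP (q.1.2, q.2)); rewrite mem_cat; apply/orP; left.
  by apply: map_f; rewrite mem_filter q0 eqxx.
move=> _ _ /mapP[q qh ->] /mapP[q' q'h ->] /= q0 q'0.
have := hP (q.1.1 *: q'.1.2 - q'.1.1 *: q.1.2, q.1.1 * q'.2 - q'.1.1 * q.2).
rewrite mem_cat.
rewrite (allpairs_f (fun q q' => (q.1.1 *: q'.1.2 - q'.1.1 *: q.1.2, q.1.1 * q'.2 - q'.1.1 * q.2)))
  ?orbT ?mem_filter ?q0 ?q'0// => /(_ isT).
by rewrite mulmxBl00 /=; lra.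
Qed.

(** A new generator adds an existential coefficient c subject to linear constraints; eliminating c
    leaves half-spaces. *)
Lemma seq_zonotope_halfspaces n (s : seq 'cV[R]_n) :
  exists h, seq_zonotope s = halfspaces h.
Proof.
elim: s => [|p s [h hE]] /=.
  (* The origin is cut out by x_i <= 0 and - x_i <= 0. *)
  exists ([seq (delta_mx 0 i, 0) | i : 'I_n] ++ [seq (- delta_mx 0 i, 0) | i : 'I_n]).
  apply/seteqP; split=> x /=.
    move=> -> q; rewrite mem_cat => /orP[]/mapP[i _ ->] /=; by rewrite mulmx0 mxE.
  move=> hx; apply/matrixP => i j; rewrite ord1 [RHS]mxE; apply/le_anti/andP; split.
    have := hx (delta_mx 0 i, 0); rewrite mem_cat map_f ?mem_enum// => /(_ isT) /=.
    by rewrite -rowE mxE.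
  have := hx (- delta_mx 0 i, 0); rewrite mem_cat.
  rewrite (map_f (fun i => (- delta_mx 0 i, 0))) ?mem_enum// orbT => /(_ isT) /=.
  by rewrite mulNmx -rowE !mxE; lra.
(* The first two triples say c <= 1 and 0 <= c; the others say that x - c p lies in the half-spaces
   of [h]. *)
exists (eliminate ((1, 0, 1) :: (-1, 0, 0) ::
  [seq (- (q.1 *m p) 0 0, q.1, q.2) | q <- h])).
apply/seteqP; split=> x /=; rewrite -eliminateP => -[c].
  move=> /andP[c0 c1]; rewrite hE => hx; exists c => q.
  rewrite !inE => /or3P[/eqP -> /=|/eqP -> /=|/mapP[q' /hx + -> /=]];
    rewrite ?mulmxBr00 ?mul0mx ?[(0 : 'M[R]_1) 0 0]mxE; lra.
move=> cP; exists c.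
  have := cP (1, 0, 1); have := cP (-1, 0, 0); rewrite !inE !eqxx ?orbT /=.
  by move=> /(_ isT) + /(_ isT); rewrite mul0mx mxE; lra.
rewrite hE => q qh; have := cP (- (q.1 *m p) 0 0, q.1, q.2).
rewrite !inE (map_f (fun q => (- (q.1 *m p) 0 0, q.1, q.2)))// !orbT => /(_ isT) /=.
by rewrite mulmxBr00; lra.
Qed.

Lemma seq_zonotope_measurable n (s : seq 'cV[R]_n) : col_measurable (seq_zonotope s).
Proof. by have [h ->] := seq_zonotope_halfspaces s; exact: halfspaces_measurable. Qed.

End ZonotopeMeasurable.

(** * Adding a unit generator *)

Section Prism.
Local Open Scope classical_set_scope.
Local Open Scope ring_scope.
Variable R : realType.
Local Notation T := (measurableTypeR R).
Local Notation leb := (@lebesgue_measure R).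

(** Convexity makes the fibres along the first axis intervals. *)
Lemma seq_zonotope_convex n (s : seq 'cV[R]_n) x y (t : R) : 0 <= t <= 1 ->
  seq_zonotope s x -> seq_zonotope s y -> seq_zonotope s (x + t *: (y - x)).
Proof.
move=> t01; elim: s x y => [|p s IHs] x y /=.
  by move=> -> ->; rewrite subrr scaler0 addr0.
move=> [c c01 xs] [d d01 ys]; exists (c + t * (d - c)); first by nra.
have -> : x + t *: (y - x) - (c + t * (d - c)) *: p =
    x - c *: p + t *: ((y - d *: p) - (x - c *: p)).
  by apply/matrixP => i j; rewrite !mxE; ring.
exact: IHs.
Qed.

Lemma seq_zonotope_bounded n (s : seq 'cV[R]_n) i :
  exists M, forall x, seq_zonotope s x -> `|x i 0| <= M.
Proof.
elim: s => [|p s [M MP]] /=.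
  by exists 0 => x ->; rewrite mxE normr0.
exists (`|p i 0| + M) => x [c c01 /MP]; rewrite !mxE => xM.
have -> : x i 0 = c * p i 0 + (x i 0 - c * p i 0) by rewrite addrC subrK.
apply: le_trans (ler_normD _ _) _; apply: lerD => //.
rewrite normrM -[leRHS]mul1r ler_wpM2r//.
by rewrite ger0_norm; case/andP: c01.
Qed.

(** Serves both for the projection along the first axis and for the change of variables that
    normalises a generator. *)
Lemma seq_zonotope_map m n (G : 'M[R]_(m, n)) (s : seq 'cV[R]_n) y :
  seq_zonotope (map (mulmx G) s) y <-> exists2 x, seq_zonotope s x & G *m x = y.
Proof.
elim: s y => [|p s IHs] y /=.
  split=> [->|[x -> <-]]; last by rewrite mulmx0.
  by exists 0; rewrite ?mulmx0.
split=> [[c c01 /IHs[x xs xE]]|[x [c c01 xs] <-]].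
  exists (x + c *: p); first by exists c; rewrite // addrK.
  by rewrite mulmxDr -scalemxAr xE subrK.
by exists c => //; apply/IHs; exists (x - c *: p); rewrite // mulmxBr -scalemxAr.
Qed.

Lemma lebesgue_measure_interval (F : set R) : is_interval F -> has_lbound F ->
  has_ubound F -> F !=set0 -> leb F = (sup F - inf F)%:E.
Proof.
move=> /is_intervalP FE lF uF F0; rewrite [in LHS]FE lebesgue_measure_itv /=.
rewrite (asboolT lF) (asboolT uF) /= lte_fin; case: ltP => // supinf.
have : inf F <= sup F.
  by have [x Fx] := F0; apply: le_trans (ge_inf lF Fx) (ub_le_sup uF Fx).
by move=> infsup; congr EFin; lra.
Qed.

(** The set is the Minkowski sum of [F] and [0, 1]; suprema and infima add. *)
Lemma lebesgue_measure_addI01 (F : set R) : is_interval F -> has_lbound F ->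
  has_ubound F -> F !=set0 ->
  leb [set x | exists2 c : R, 0 <= c <= 1 & F (x - c)] = (leb F + 1)%E.
Proof.
move=> iF lF uF F0.
have -> : [set x | exists2 c : R, 0 <= c <= 1 & F (x - c)] =
    [set x + y | x in F & y in `[0, 1]%classic].
  apply/seteqP; split=> x /=.
    by move=> [c c01 Fx]; exists (x - c) => //; exists c => /=; rewrite ?in_itv ?subrK.
  by move=> [y Fy [c]]; rewrite in_itv/= => c01 <-; exists c; rewrite ?addrK.
have i01 : has_inf (`[0, 1]%classic : set R).
  by split; [exists 0; rewrite /= in_itv/= lexx ler01|exists 0 => x /=; rewrite in_itv/= => /andP[]].
have s01 : has_sup (`[0, 1]%classic : set R).
  by split; [exists 0; rewrite /= in_itv/= lexx ler01|exists 1 => x /=; rewrite in_itv/= => /andP[]].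
rewrite !lebesgue_measure_interval//.
- rewrite sup_sumE// inf_sumE// sup_itv ?bnd_simp// inf_itv ?bnd_simp//.
  by rewrite -EFinD; congr EFin; ring.
(* The sum is an interval: z is x + (z - x) if z <= x + 1, and otherwise (z - 1) + 1 with z - 1
   between x and y. *)
- move=> _ _ [x Fx [c c01 <-]] [y Fy [d d01 <-]] z zP.
  move: c01 d01; rewrite /= !in_itv/= => c01 d01.
  have [zx|xz] := leP z (x + 1); last first.
    have [zy|yz] := leP (z - 1) y.
      exists (z - 1); last by exists 1; rewrite ?in_itv/= ?subrK// ler01 lexx.
      by apply: iF Fx Fy _ _; lra.
    by exfalso; lra.
  have [xz|zx'] := leP x z.
    by exists x => //; exists (z - x); rewrite ?in_itv/=; lra.
  by exfalso; lra.
- have [l lP] := lF; exists l => _ [x Fx [c c01 <-]].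
  move: c01; rewrite /= in_itv/= => c01; have := lP _ Fx; lra.
- have [u uP] := uF; exists (u + 1) => _ [x Fx [c c01 <-]].
  move: c01; rewrite /= in_itv/= => c01; have := uP _ Fx; lra.
- have [x Fx] := F0; exists (x + 0); exists x => //; exists 0 => //.
  by rewrite /= in_itv/= lexx ler01.
Qed.

(** The matrix [row_mx 0 1%:M] drops the first coordinate, so the last term is the volume of the
    projection. *)
Lemma volume_prism n (s : seq 'cV[R]_(1 + n)) :
  volume (seq_zonotope (col_mx 1%:M 0 :: s)) =
  (volume (seq_zonotope s) + volume (seq_zonotope (map (mulmx (row_mx 0 1%:M)) s)))%E.
Proof.
set Z' := seq_zonotope (_ :: s); set Z := seq_zonotope s.
pose pZ := [set t : n.-tuple T | seq_zonotope (map (mulmx (row_mx 0 1%:M)) s) (\col_i tnth t i)].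
have mpZ : measurable pZ by exact: seq_zonotope_measurable.
have mZ : col_measurable Z by exact: seq_zonotope_measurable.
rewrite !volumeS_fiber//; last exact: seq_zonotope_measurable.
(* The volume of the projection is the integral of its indicator, so it suffices to compare
   integrands. *)
rewrite [X in (_ + X)%E](_ : _ = \int[lebesgue_tuple R n]_t (\1_pZ t)%:E)%E; last first.
  by rewrite integral_indic// setIT.
rewrite -ge0_integralD//; last 2 first.
- exact: measurable_fun_fiber.
- by apply/measurable_EFinP.
apply: eq_integral => t _; set y := \col_i _.
have fE x : Z' (col_mx x%:M y) <-> exists2 c : R, 0 <= c <= 1 & Z (col_mx (x - c)%:M y).
  suff e c : col_mx x%:M y - c *: col_mx 1%:M 0 = col_mx (x - c)%:M y.
    by split=> -[c c01 H]; exists c => //; move: H; rewrite e.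
  rewrite (@scale_col_mx _ 1 n 1) scaler0 scale_scalar_mx mulr1.
  by rewrite (@opp_col_mx _ 1 n 1) (@add_col_mx _ 1 n 1) oppr0 addr0 raddfB.
rewrite (_ : [set x | Z' (col_mx x%:M y)] =
  [set x | exists2 c : R, 0 <= c <= 1 & [set x | Z (col_mx x%:M y)] (x - c)]); last first.
  by apply/seteqP; split => x /=; rewrite fE.
have pZE : pZ t <-> exists x, Z (col_mx x%:M y).
  rewrite /pZ/= seq_zonotope_map; split=> [[x Zx xy]|[x Zx]].
    exists (usubmx x 0 0); rewrite -mx11_scalar (_ : y = dsubmx x) ?vsubmxK//.
    by rewrite -[LHS]xy -[in LHS](vsubmxK x) mul_row_col mul0mx mul1mx add0r.
  by exists (col_mx x%:M y) => //; rewrite mul_row_col mul0mx mul1mx add0r.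
(* Over the projection the fibre of [Z] is a nonempty bounded interval; elsewhere both fibres are
   empty. *)
rewrite indicE; case: (asboolP (pZ t)) => [/[dup] pt|pt].
  move=> /pZE[x0 Zx0]; rewrite mem_set//; apply: lebesgue_measure_addI01.
  - move=> u v /= Zu Zv w uwv.
    have [uv|vu] := eqVneq u v.
      by have -> : w = u by lra.
    have {}vu : u < v by rewrite lt_neqAle vu; lra.
    have -> : col_mx w%:M y = col_mx u%:M y +
        ((w - u) / (v - u)) *: (col_mx v%:M y - col_mx u%:M y).
      rewrite (@opp_col_mx _ 1 n 1) (@add_col_mx _ 1 n 1) subrr (@scale_col_mx _ 1 n 1) scaler0.
      rewrite (@add_col_mx _ 1 n 1) addr0; congr col_mx.
      rewrite -raddfB scale_scalar_mx -raddfD; congr (_%:M).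
      by field; rewrite subr_eq0 gt_eqF.
    apply: seq_zonotope_convex => //.
    rewrite divr_ge0 ?subr_ge0 ?(ltW vu)//=; last by case/andP: uwv.
    by rewrite ler_pdivrMr ?subr_gt0// mul1r lerB//; case/andP: uwv.
  - have [M MP] := seq_zonotope_bounded s (lshift n ord0).
    by exists (- M) => x /= /MP; rewrite col_mxEu mxE mulr1n ler_norml => /andP[].
  - have [M MP] := seq_zonotope_bounded s (lshift n ord0).
    by exists M => x /= /MP; rewrite col_mxEu mxE mulr1n ler_norml => /andP[].
  - by exists x0.
rewrite memNset// addr0.
have F0 : [set x | Z (col_mx x%:M y)] = set0.
  by apply/seteqP; split => x //= Zx; apply: pt; apply/pZE; exists x.
rewrite F0 measure0 (_ : mkset _ = set0) ?measure0//.
by apply/seteqP; split => x //= -[].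
Qed.

End Prism.

(** * Volume as a sum of minors *)

Section Subsequences.
Local Open Scope nat_scope.

(** Choices are made by position, so equal entries count separately, as equal columns of a matrix
    must. *)
Fixpoint subseqs X (l : nat) (s : seq X) : seq (seq X) :=
  match l, s with
  | 0, _ => [:: [::]]
  | _.+1, [::] => [::]
  | l'.+1, x :: s' => map (cons x) (subseqs l' s') ++ subseqs l s'
  end.

Lemma subseqs0 X (s : seq X) : subseqs 0 s = [:: [::]].
Proof. by case: s. Qed.

Lemma map_subseqs X Y (f : X -> Y) l (s : seq X) :
  subseqs l (map f s) = map (map f) (subseqs l s).
Proof.
elim: s l => [|x s IHs] [|l] //=.
by rewrite map_cat !IHs -!map_comp.
Qed.

Lemma size_subseqs X l (s : seq X) : size (subseqs l s) = 'C(size s, l).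
Proof.
elim: s l => [|x s IHs] [|l] //=.
by rewrite size_cat size_map !IHs binS addnC.
Qed.

Lemma mem_subseqs (X : eqType) l (s u : seq X) :
  (u \in subseqs l s) = (size u == l) && subseq u s.
Proof.
elim: s l u => [|x s IHs] [|l] u.
- by rewrite subseqs0 inE; case: u.
- by case: u => // a u; rewrite andbF.
- by rewrite subseqs0 inE; case: u => // a u; rewrite /= eqE.
rewrite [subseqs _ _]/= mem_cat IHs; case: u => [|y u] /=.
  by rewrite orbF; apply/negP => /mapP[].
rewrite eqSS; case: (eqVneq y x) => [->|/eqP yx].
  rewrite mem_map ?IHs; last by move=> ? ? [].
  by case: (size u == l) => //=; apply: orb_idr; exact: subseq_trans (subseq_cons _ _).
apply: orb_idl => /mapP[? _ [/yx]]; by [].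
Qed.

Lemma subseqs_uniq (X : eqType) l (s : seq X) : uniq s -> uniq (subseqs l s).
Proof.
elim: s l => [|x s IHs] [|l] //= /andP[xs us].
rewrite cat_uniq !IHs// map_inj_uniq ?IHs//; last by move=> ? ? [].
rewrite andbT; apply/hasPn => u; rewrite mem_subseqs => /andP[_ us'] /=.
apply/negP => /mapP[v _ uE]; move/negP: xs; apply.
by apply: (mem_subseq us'); rewrite uE mem_head.
Qed.

Lemma size_mem_subseqs X l (s : seq X) : all (fun u => size u == l) (subseqs l s).
Proof.
elim: s l => [|x s IHs] [|l] //=.
by rewrite all_cat all_map IHs andbT; apply: sub_all (IHs l) => u /= /eqP ->.
Qed.

(** The binomial times l! is a falling factorial, a product of l factors at most m. *)
Lemma leq_bin_exp m l : ('C(m, l) <= m ^ l).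
Proof.
apply: leq_trans (_ : 'C(m, l) * l`! <= _); first by rewrite leq_pmulr ?fact_gt0.
rewrite bin_ffact; elim: l => [|l IHl]; first by rewrite ffactn0.
by rewrite ffactnSr expnSr leq_mul// leq_subr.
Qed.

End Subsequences.

(** * Minors of a list of columns and the volume formula *)

Section ZonotopeVolume.
Local Open Scope classical_set_scope.
Local Open Scope ring_scope.
Variable R : realType.

Definition seq_mx n (u : seq 'cV[R]_n) : 'M[R]_n := \matrix_(i, j) (nth 0 u j) i 0.

Definition minors n (s : seq 'cV[R]_n) : R := \sum_(u <- subseqs n s) `|\det (seq_mx u)|.

Lemma eq_big_subseqs X (f g : seq X -> R) l (s : seq X) :
  (forall u, size u = l -> f u = g u) ->
  \sum_(u <- subseqs l s) f u = \sum_(u <- subseqs l s) g u.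
Proof.
move=> fg; rewrite -[subseqs l s](all_filterP (size_mem_subseqs l s)).
by rewrite !big_filter; apply: eq_bigr => u /eqP /fg.
Qed.

Lemma seq_mx_map n (G : 'M[R]_n) (u : seq 'cV[R]_n) : size u = n ->
  seq_mx (map (mulmx G) u) = G *m seq_mx u.
Proof.
move=> un; apply/matrixP => i j; rewrite !mxE (nth_map 0) ?un// mxE.
by apply: eq_bigr => k _; rewrite mxE.
Qed.

Lemma minors_map n (G : 'M[R]_n) (s : seq 'cV[R]_n) :
  minors (map (mulmx G) s) = `|\det G| * minors s.
Proof.
rewrite /minors map_subseqs big_map mulr_sumr; apply: eq_big_subseqs => u un.
by rewrite seq_mx_map// det_mulmx normrM.
Qed.

Lemma minors_cons n (p : 'cV[R]_n.+1) (s : seq 'cV[R]_n.+1) :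
  minors (p :: s) = \sum_(u <- subseqs n s) `|\det (seq_mx (p :: u))| + minors s.
Proof. by rewrite /minors /= big_cat big_map. Qed.

Lemma minors_cons0 n (s : seq 'cV[R]_n) : (0 < n)%N -> minors (0 :: s) = minors s.
Proof.
case: n s => // n s _; rewrite minors_cons big1 ?add0r// => u _.
rewrite (expand_det_col _ ord0) big1 ?normr0// => i _.
by rewrite !mxE /= ?mxE mul0r.
Qed.

(** A matrix with first column e_1 is block triangular, and its lower right block consists of
    projected columns. This is the counterpart of [volume_prism]. *)
Lemma minors_e0 n (s : seq 'cV[R]_(1 + n)) :
  minors (col_mx 1%:M 0 :: s) =
  minors s + minors (map (mulmx (row_mx 0 1%:M : 'M[R]_(n, 1 + n))) s).
Proof.
rewrite minors_cons addrC; congr (_ + _).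
rewrite /minors map_subseqs big_map; apply: eq_big_subseqs => u un.
pose D : 'M[R]_n := seq_mx (map (mulmx (row_mx 0 1%:M : 'M[R]_(n, 1 + n))) u).
have -> : seq_mx ((col_mx 1%:M 0 : 'cV[R]_(1 + n)) :: u) =
    block_mx 1%:M (\row_j (nth 0 u j) 0 0) 0 D :> 'M[R]_(1 + n).
  apply/matrixP => i j; rewrite [LHS]mxE.
  case: (split_ordP j) => k ->; case: (split_ordP i) => l -> /=.
  - by rewrite !ord1 block_mxEul col_mxEu.
  - by rewrite !ord1 block_mxEdl col_mxEd.
  - by rewrite !ord1 block_mxEur mxE; congr (_ _ _); apply: val_inj.
  rewrite block_mxEdr mxE (nth_map 0) ?un//.
  rewrite -[X in _ = (_ *m X) _ _](@vsubmxK _ 1 n 1) mul_row_col mul0mx mul1mx add0r mxE.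
  by congr (_ _ _).
by rewrite (@det_ublock _ 1 n) det1 mul1r.
Qed.

Lemma seq_zonotope0 n (s : seq 'cV[R]_n) : seq_zonotope s 0.
Proof. by elim: s => //= p s IHs; exists 0; rewrite ?lexx ?ler01// scale0r subr0. Qed.

Lemma seq_zonotope_cons0 n (s : seq 'cV[R]_n) : seq_zonotope (0 :: s) = seq_zonotope s.
Proof.
apply/seteqP; split => x /=; first by move=> [c _]; rewrite scaler0 subr0.
by move=> xs; exists 0; rewrite ?lexx ?ler01// scaler0 subr0.
Qed.

(** The origin is a box with all sides of length 0, and in positive dimension the product has a zero
    factor. *)
Lemma volume_set0 n : volume ([set 0] : set 'cV[R]_n.+1) = 0.
Proof.
have := lebesgue_tuple_box (a := fun _ : 'I_n.+1 => 0 : R) (b := fun _ => 0) (fun _ => lexx _).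
rewrite big_ord_recl subrr mul0r => H0; apply: etrans H0.
congr (lebesgue_tuple _ _ _).
apply/seteqP; split=> t /= H.
  by move=> i; move/matrixP: H => /(_ i 0); rewrite !mxE => ->; rewrite lexx.
by apply/matrixP => i j; rewrite !mxE; apply/le_anti; rewrite andbC H.
Qed.

Lemma volume_seq_zonotope n (s : seq 'cV[R]_n) :
  volume (seq_zonotope s) = (minors s)%:E.
Proof.
(* The induction is on a bound for the length with [n] generalised, because the projection lowers
   the dimension. *)
have [m] := ubnP (size s); elim: m => // m IHm in n s *; rewrite ltnS => sm.
case: n s sm => [|n] s sm.
  (* In dimension 0 the volume is a Dirac mass at the only point and the only minor is the empty
     determinant; both are 1. *)
  rewrite /minors subseqs0 big_seq1 det_mx00 normr1.
  rewrite /volume /= diracE mem_set//= (_ : \col_i _ = 0) ?flatmx0//; exact: seq_zonotope0.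
case: s sm => [|p s] sm; first by rewrite volume_set0 /minors big_nil.
have [->|/scales_volume_to_e0[G [uG GE] Gp]] := eqVneq p 0.
  by rewrite seq_zonotope_cons0 minors_cons0// IHm.
have d0 : `|\det G| != 0 by rewrite normr_eq0 -unitfE -unitmxE.
have preE : [set x | seq_zonotope (map (mulmx G) (p :: s)) (G *m x)] = seq_zonotope (p :: s).
  apply/seteqP; split => x; last by move=> xs; apply/seq_zonotope_map; exists x.
  by move=> /seq_zonotope_map[y ys]; move/(congr1 (mulmx (invmx G))); rewrite !mulKmx// => <-.
have := GE _ (seq_zonotope_measurable (map (mulmx G) (p :: s))).
rewrite preE => volE.
(* Volume and minors both scale by |det G|, so the claim passes to the generators moved by [G], the
   first of which is e_1. *)
rewrite -[LHS]mul1e -(mulVf d0) EFinM -muleA -volE.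
rewrite [map _ (p :: s)]/= Gp volume_prism !IHm ?size_map// -EFinD -minors_e0 -Gp.
by rewrite -[_ :: _]/(map (mulmx G) (p :: s)) minors_map -EFinM mulKf.
Qed.

End ZonotopeVolume.

(** * Splitting subsequences over a concatenation *)

(* The length is an integer so that the differences n - j - k need no
   truncation: a negative length gives the empty list. *)
Definition subseqsZ X (z : int) (s : seq X) : seq (seq X) :=
  if z is Posz l then subseqs l s else [::].

Section BigSubseqs.
Variables (X : Type) (V : nmodType).
Implicit Types (s : seq X) (f : seq X -> V).

(** Either [x] is chosen or it is not; at z = 0 the first sum has length -1 and is empty. *)
Lemma big_subseqsZ_cons z x s f :
  \sum_(u <- subseqsZ z (x :: s)) f u =
  \sum_(u <- subseqsZ (z - 1) s) f (x :: u) + \sum_(u <- subseqsZ z s) f u.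
Proof.
case: z => [[|l]|l].
- by rewrite sub0r /= !subseqs0 big_nil add0r.
- by rewrite -addn1 PoszD addrK /= addn1 big_cat big_map.
- by rewrite (_ : Negz l - 1 = Negz l.+1) /= ?big_nil ?addr0//; lia.
Qed.

Lemma subseqs_large l s : (size s < l)%N -> subseqs l s = [::].
Proof. by move=> sl; apply: size0nil; rewrite size_subseqs bin_small. Qed.

(** The choices are sorted by the number j of entries taken from [s1]. *)
Lemma big_subseqsZ_catl z s1 s2 f :
  \sum_(u <- subseqsZ z (s1 ++ s2)) f u =
  \sum_(j < (size s1).+1) \sum_(a <- subseqsZ j s1)
    \sum_(b <- subseqsZ (z - j%:Z) s2) f (a ++ b).
Proof.
elim: s1 z f => [|x s1 IHs] z f.
  by rewrite big_ord1 big_seq1 subr0.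
rewrite cat_cons big_subseqsZ_cons !IHs.
under [RHS]eq_bigr do rewrite big_subseqsZ_cons.
rewrite big_split/=; congr (_ + _).
  (* The term j = 0 has length -1 and vanishes; the others are shifted by one. *)
  rewrite [RHS]big_ord_recl sub0r [X in _ = X + _]big_nil add0r.
  apply: eq_bigr => j _; rewrite lift0.
  have e1 : j.+1%:Z - 1 = j%:Z by rewrite -addn1 PoszD addrK.
  have e2 : z - j.+1%:Z = z - 1 - j%:Z by rewrite -addn1 PoszD opprD addrA addrAC.
  by rewrite e1 e2.
(* The last j exceeds the size of [s1], so its term is empty. *)
by rewrite [RHS]big_ord_recr /= subseqs_large// big_nil addr0.
Qed.

(** Turns a length into a summation index, so that the order of summation can be exchanged. *)
Lemma big_subseqsZ_pick z s f :
  \sum_(u <- subseqsZ z s) f u =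
  \sum_(k < (size s).+1 | z == k%:Z) \sum_(u <- subseqsZ k s) f u.
Proof.
case: z => [l|l]; last by rewrite big_nil big_pred0.
have [ls|sl] := ltnP l (size s).+1.
  by rewrite (big_pred1 (Ordinal ls))// => k; rewrite -val_eqE /= eqz_nat eq_sym.
rewrite /= subseqs_large// big_nil big_pred0// => k.
by rewrite eqz_nat; apply/negP => /eqP lk; move: sl; rewrite lk ltnNge -ltnS ltn_ord.
Qed.

Lemma big_subseqsZ_catr z s1 s2 f :
  \sum_(u <- subseqsZ z (s1 ++ s2)) f u =
  \sum_(k < (size s2).+1) \sum_(a <- subseqsZ (z - k%:Z) s1)
    \sum_(b <- subseqsZ k s2) f (a ++ b).
Proof.
rewrite big_subseqsZ_catl.
under eq_bigr => j _.
  under eq_bigr do rewrite big_subseqsZ_pick.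
  rewrite exchange_big /=; over.
under [RHS]eq_bigr do rewrite big_subseqsZ_pick.
(* The conditions z - j = k and z - k = j are the same, so the inner sum over j is again of the form
   in [big_subseqsZ_pick]. *)
rewrite (exchange_big_dep predT)//=; apply: eq_bigr => k _.
by apply: eq_bigl => j; rewrite !subr_eq addrC.
Qed.

Lemma big_catprod (S S' : seq (seq nat)) (f : seq nat -> V) :
  \sum_(u <- catprod S S') f u = \sum_(a <- S) \sum_(b <- S') f (a ++ b).
Proof. by rewrite /catprod big_allpairs_dep. Qed.

End BigSubseqs.

(** * Inclusion-exclusion on the first and last parts of a list *)

Section Inclusion.
Variables (V : zmodType) (f : seq nat -> V) (n : int).

Definition mixed (s0 s1 s2 : seq nat) (j k : nat) :=
  \sum_(u <- catprod (catprod (subseqsZ j s0) (subseqsZ (n - j%:Z - k%:Z) s1))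
    (subseqsZ k s2)) f u.

Lemma big_subseqsZ_cat3 (s0 s1 s2 : seq nat) :
  \sum_(u <- subseqsZ n (s0 ++ s1 ++ s2)) f u =
  \sum_(0 <= j < (size s0).+1) \sum_(0 <= k < (size s2).+1) mixed s0 s1 s2 j k.
Proof.
rewrite big_subseqsZ_catl big_mkord; apply: eq_bigr => j _.
under eq_bigr do rewrite big_subseqsZ_catr.
rewrite exchange_big big_mkord; apply: eq_bigr => k _.
rewrite /mixed !big_catprod; apply: eq_bigr => a _; apply: eq_bigr => b _.
by apply: eq_bigr => c _; rewrite catA.
Qed.

(** Each sum adds the terms [mixed] over a region of (j, k): all of it, the axis k = 0, the axis j =
    0, or the origin. The part off both axes remains. *)
Lemma big_subseqsZ_inclusion_exclusion (s0 s1 s2 : seq nat) :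
  \sum_(u <- subseqsZ n (s0 ++ s1 ++ s2)) f u =
  \sum_(u <- subseqsZ n (s0 ++ s1)) f u + \sum_(u <- subseqsZ n (s1 ++ s2)) f u
  - \sum_(u <- subseqsZ n s1) f u
  + \sum_(1 <= j < (size s0).+1) \sum_(1 <= k < (size s2).+1) mixed s0 s1 s2 j k.
Proof.
pose m := mixed s0 s1 s2.
(* Choosing nothing from a list is the same as replacing it by the empty list. *)
have mixed_r j : mixed s0 s1 [::] j 0%N = m j 0%N by rewrite /m /mixed/= !subseqs0.
have mixed_l k : mixed [::] s1 s2 0%N k = m 0%N k by rewrite /m /mixed/= !subseqs0.
have mixed_lr : mixed [::] s1 [::] 0%N 0%N = m 0%N 0%N by rewrite /m /mixed/= !subseqs0.
have -> : \sum_(u <- subseqsZ n s1) f u = m 0%N 0%N.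
  by have := big_subseqsZ_cat3 [::] s1 [::]; rewrite cats0 /= !big_nat1 mixed_lr.
have -> : \sum_(u <- subseqsZ n (s0 ++ s1)) f u = m 0%N 0%N + \sum_(1 <= j < (size s0).+1) m j 0%N.
  have := big_subseqsZ_cat3 s0 s1 [::]; rewrite cats0 => ->; rewrite big_ltn// big_nat1 mixed_r.
  by congr (_ + _); apply: eq_bigr => j _; rewrite big_nat1 mixed_r.
have -> : \sum_(u <- subseqsZ n (s1 ++ s2)) f u = m 0%N 0%N + \sum_(1 <= k < (size s2).+1) m 0%N k.
  have := big_subseqsZ_cat3 [::] s1 s2; rewrite /= => ->; rewrite big_nat1 big_ltn// mixed_l.
  by congr (_ + _); apply: eq_bigr => k _; rewrite mixed_l.
rewrite big_subseqsZ_cat3 big_ltn// [X in X + _ = _]big_ltn// -/m.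
have -> : \sum_(1 <= j < (size s0).+1) \sum_(0 <= k < (size s2).+1) mixed s0 s1 s2 j k =
    \sum_(1 <= j < (size s0).+1) m j 0%N +
    \sum_(1 <= j < (size s0).+1) \sum_(1 <= k < (size s2).+1) m j k.
  by rewrite -big_split; apply: eq_bigr => j _; rewrite big_ltn.
rewrite addrA; congr (_ + _); move: (\sum_(1 <= k < _) _) => x.
by rewrite [RHS]addrAC (addrC (m 0%N 0%N) x) addrK addrC.
Qed.

End Inclusion.

(** * The index sets as subsequences of intervals *)

Section ThetaSubseqs.
Local Open Scope nat_scope.

Lemma subseq_iota m k (u : seq nat) :
  subseq u (iota m k) = sorted ltn u && all (fun i => m <= i < m + k) u.
Proof.
apply/idP/andP => [us|[su au]].
  split; first exact: (subseq_sorted ltn_trans us (iota_ltn_sorted _ _)).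
  by apply/allP => i /(mem_subseq us); rewrite mem_iota.
(* A strictly increasing list is determined by its members, so [u] is the interval filtered by
   membership in [u]. *)
apply/(subseq_uniqP (iota_uniq m k)).
apply: (irr_sorted_eq ltn_trans ltnn) => //.
  exact: sorted_filter ltn_trans _ _ (iota_ltn_sorted _ _).
move=> i; rewrite mem_filter mem_iota; apply/idP/andP => [iu|[]//].
by split => //; exact: (allP au).
Qed.

Lemma mem_subseqsZ (X : eqType) (z : int) (s u : seq X) :
  (u \in subseqsZ z s) = (z == (size u)%:Z) && subseq u s.
Proof. by case: z => [l|//]; rewrite mem_subseqs eqz_nat eq_sym. Qed.

(** The case a = b + 1 is the empty range, which occurs for the middle blocks when N = 2. Sums and
    sizes only need equality up to order. *)
Lemma Theta_subseqsZ r a b z : a <= b.+1 ->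
  perm_eq (Theta r a b z) (subseqsZ z (iota (r * a + 1) (r * (b.+1 - a)))).
Proof.
move=> ab; apply: uniq_perm; first exact: Theta_uniq.
  by case: z => [l|//]; apply: subseqs_uniq; exact: iota_uniq.
move=> u; rewrite mem_Theta mem_subseqsZ subseq_iota; congr [&& _, _ & _].
apply: eq_all => i; rewrite addn1 addSn ltnS -mulnDr subnKC//.
Qed.

End ThetaSubseqs.

(** * The reachability matrix *)

Section Reach.
Local Open Scope classical_set_scope.
Local Open Scope ring_scope.
Variables (R : realType) (n r : nat).
Implicit Types (A : 'M[R]_n) (B : 'M[R]_(n, r)).

Lemma zonotope_seq m (P : 'M[R]_(n, m)) :
  zonotope P = seq_zonotope [seq col i P | i <- enum 'I_m].
Proof.
(* Induction needs an arbitrary duplicate-free list of indices in place of the full enumeration. *)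
suff seqE (s : seq 'I_m) x : uniq s -> seq_zonotope [seq col i P | i <- s] x <->
    exists c : 'I_m -> R, (forall i, 0 <= c i <= 1) /\ x = \sum_(i <- s) c i *: col i P.
  apply/seteqP; split=> x.
    by move=> [c [c01 ->]]; apply/seqE; [exact: enum_uniq|exists c; rewrite big_enum].
  move=> /seqE[]; first exact: enum_uniq.
  by move=> c [c01 ->]; exists c; rewrite big_enum.
elim: s x => [|i s IHs] x /=.
  split=> [->|[c [_ ->]]]; last by rewrite big_nil.
  by exists (fun=> 0); rewrite big_nil; split => // i; rewrite lexx ler01.
move=> /andP[is_ us]; split=> [[d d01 /(IHs _ us)[c [c01 xE]]]|[c [c01 ->]]].
  (* Changing the coefficient at [i] does not affect the sum over [s], which omits [i]. *)
  exists (fun k => if k == i then d else c k); split=> [k|]; first by case: ifP.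
  rewrite big_cons eqxx -[x](subrK (d *: col i P)) xE addrC; congr (_ + _).
  apply: eq_big_seq => k ks; case: eqP => // ki; by rewrite -ki ks in is_.
exists (c i) => //; apply/IHs => //; exists c.
by rewrite big_cons addrC addKr.
Qed.

Lemma block_index M i : (1 <= i <= r * M)%N ->
  exists (a : 'I_M) (c : 'I_r), i = (r * a + c.+1)%N.
Proof.
case: i => // i /=; case: (posnP r) => [->|r0 iM]; first by rewrite mul0n.
have aM : (i %/ r < M)%N by rewrite ltn_divLR// mulnC.
exists (Ordinal aM), (Ordinal (ltn_pmod i r0)) => /=.
by rewrite addnS mulnC -divn_eq.
Qed.

Lemma reach_col_widen A B M N i : (M <= N)%N -> (1 <= i <= r * M)%N ->
  reach_col A B N i = reach_col A B M i.
Proof.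
move=> MN /block_index[a [c ->]].
by rewrite reach_col_block -(reach_col_block A B (widen_ord MN a)).
Qed.

(** Multiplication by [A] moves each block to the next, that is, each index by [r]. *)
Lemma reach_col_shift A B M i : (1 <= i <= r * M)%N ->
  reach_col A B M.+1 (r + i) = A *m reach_col A B M i.
Proof.
move=> /block_index[a [c ->]]; rewrite reach_col_block addnA -mulnS.
rewrite -[a.+1]/(nat_of_ord (lift ord0 a)) reach_col_block lift0.
by rewrite exprS -mulmxE !colE !mulmxA.
Qed.

Lemma cols_mxE A B M (u : seq nat) : size u = n ->
  cols_mx A B M u = seq_mx [seq reach_col A B M i | i <- u].
Proof. by move=> un; apply/matrixP => i j; rewrite !mxE (nth_map 0%N) ?un. Qed.

Lemma reach_cols A B M :
  [seq col i (reach_mx A B M) | i <- enum 'I_(\sum_(k < M) r)] =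
  [seq reach_col A B M i | i <- iota 1 (r * M)].
Proof.
have mE : (\sum_(k < M) r = r * M)%N by rewrite sum_nat_const card_ord mulnC.
rewrite -mE (iotaDl 1 0) -val_enum_ord -!map_comp; apply: eq_map => i /=.
by rewrite /reach_col add1n /= valK.
Qed.

Definition reach_volume A B M : R :=
  \sum_(u <- subseqs n (iota 1 (r * M))) `|\det (cols_mx A B M u)|.

Lemma volume_reach A B M :
  volume (zonotope (reach_mx A B M)) = (reach_volume A B M)%:E.
Proof.
rewrite zonotope_seq reach_cols volume_seq_zonotope; congr EFin.
rewrite /minors map_subseqs big_map; apply: eq_big_subseqs => u un.
by rewrite cols_mxE.
Qed.

Lemma mem_subseqs_iota l m k (u : seq nat) : u \in subseqs l (iota m k) ->
  size u = l /\ {in u, forall i, (m <= i < m + k)%N}.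
Proof.
rewrite mem_subseqs => /andP[/eqP -> us]; split => // i /(mem_subseq us).
by rewrite mem_iota.
Qed.

Lemma reach_volume_widen A B M N : (M <= N)%N ->
  \sum_(u <- subseqs n (iota 1 (r * M))) `|\det (cols_mx A B N u)| = reach_volume A B M.
Proof.
move=> MN; apply: eq_big_seq => u /mem_subseqs_iota[un uM].
rewrite !cols_mxE//; congr (`|\det (seq_mx _)|); apply/eq_in_map => i /uM iM.
exact: reach_col_widen.
Qed.

(** Blocks 1 to M are [A] times blocks 0 to M - 1, so |det A| factors out of every minor. *)
Lemma reach_volume_shift A B M N : (M < N)%N ->
  \sum_(u <- subseqs n (iota (r + 1) (r * M))) `|\det (cols_mx A B N u)| =
  `|\det A| * reach_volume A B M.
Proof.
move=> MN; rewrite iotaDl map_subseqs big_map mulr_sumr.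
apply: eq_big_seq => u /mem_subseqs_iota[un uM].
rewrite !cols_mxE ?size_map// -normrM -det_mulmx -seq_mx_map ?size_map// -!map_comp.
congr (`|\det (seq_mx _)|); apply/eq_in_map => i /uM iM /=.
rewrite -reach_col_shift; last lia.
by rewrite (reach_col_widen A B MN)// mulnS; lia.
Qed.

Definition reach_mixed A B N : R :=
  \sum_(1 <= j < r.+1) \sum_(1 <= k < r.+1)
    \sum_(s <- catprod (catprod (Theta r 0 0 j) (Theta r 1 (N - 2) (n%:Z - j%:Z - k%:Z)))
                       (Theta r (N - 1) (N - 1) k)) `|\det (cols_mx A B N s)|.

Lemma reach_volume_rec A B N : (2 <= N)%N ->
  reach_volume A B N = (1 + `|\det A|) * reach_volume A B (N - 1)
    - `|\det A| * reach_volume A B (N - 2) + reach_mixed A B N.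
Proof.
case: N => [|[|N]]// _; rewrite subn1 subn2 /=.
have iota01 : iota 1 r ++ iota (r + 1) (r * N) = iota 1 (r * N.+1).
  by rewrite mulnS iotaD addnC.
have iota12 : iota (r + 1) (r * N) ++ iota (r * N.+1 + 1) r = iota (r + 1) (r * N.+1).
  have -> : (r * N.+1 = r * N + r)%N by rewrite mulnS addnC.
  by rewrite iotaD -addnA [(r * N + _)%N]addnC.
(* The three parts are block 0, blocks 1 to N and block N + 1. *)
have iotaE : iota 1 (r * N.+2) = iota 1 r ++ iota (r + 1) (r * N) ++ iota (r * N.+1 + 1) r.
  by rewrite iota12 mulnS iotaD addnC.
rewrite {1}/reach_volume iotaE.
have := big_subseqsZ_inclusion_exclusion (fun u => `|\det (cols_mx A B N.+2 u)|) n
  (iota 1 r) (iota (r + 1) (r * N)) (iota (r * N.+1 + 1) r).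
rewrite /= => ->; rewrite iota01 iota12 reach_volume_widen// !reach_volume_shift// !size_iota.
rewrite mulrDl mul1r; congr (_ + _).
apply: eq_bigr => j _; apply: eq_bigr => k _; rewrite /mixed !big_catprod.
have T0 := @Theta_subseqsZ r 0 0 j isT.
have T1 := @Theta_subseqsZ r 1 N (n%:Z - j%:Z - k%:Z) isT.
have T2 := @Theta_subseqsZ r N.+1 N.+1 k (leqnSn _).
rewrite muln0 add0n subn0 muln1 in T0.
rewrite muln1 subn1 /= in T1.
rewrite subSnn muln1 in T2.
rewrite !subSS !subn0 -(perm_big _ T0); apply: eq_bigr => a _.
rewrite -(perm_big _ T1); apply: eq_bigr => b _.
by rewrite -(perm_big _ T2).
Qed.

(** Justifies the initial value 0 in [crec]. *)
Lemma reach_volume0 A B : (0 < n)%N -> reach_volume A B 0 = 0.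
Proof. by move=> n0; rewrite /reach_volume muln0 subseqs_large ?big_nil. Qed.

(** * Value and cost of the recursive computation *)

Lemma csum_value X (f : X -> counted R) (s : seq X) : (csum f s).1 = \sum_(x <- s) (f x).1.
Proof. by elim: s => [|x s IHs]; rewrite ?big_nil// big_cons -IHs. Qed.

Lemma csum_cost X (f : X -> counted R) (s : seq X) :
  (csum f s).2 = (\sum_(x <- s) (f x).2)%N.
Proof. by elim: s => [|x s IHs]; rewrite ?big_nil// big_cons -IHs /= addn0. Qed.

Lemma csum_mixed_value A B N : (csum_mixed A B N).1 = reach_mixed A B N.
Proof.
have iotaE : index_iota 1 r.+1 = iota 1 r by rewrite /index_iota subn1.
rewrite /csum_mixed csum_value /reach_mixed iotaE.
apply: eq_bigr => j _; rewrite csum_value; apply: eq_bigr => k _.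
by rewrite /csum_absdet csum_value.
Qed.

Lemma crec_value A B m : (0 < n)%N ->
  (crec A B (reach_volume A B 1) (\det A) m).1 = (reach_volume A B m.+1, reach_volume A B m).
Proof.
move=> n0; elim: m => [|m IHm]; first by rewrite /= reach_volume0.
rewrite (reach_volume_rec A B (isT : 2 <= m.+2)%N) subn1 subn2 -csum_mixed_value.
by rewrite /= IHm.
Qed.

Lemma csum_absdet_Theta0 A B :
  (csum_absdet A B 1 (Theta r 0 0 n)).1 = reach_volume A B 1.
Proof.
have T0 := @Theta_subseqsZ r 0 0 n isT; rewrite muln0 subn0 in T0.
by rewrite csum_value (perm_big _ T0).
Qed.

Lemma cvolume_value A B N : (0 < n)%N -> (0 < N)%N ->
  (cvolume A B N).1 = reach_volume A B N.
Proof.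
move=> n0; case: N => // N _.
by rewrite /cvolume /= csum_absdet_Theta0 crec_value.
Qed.

Lemma size_Theta a b z : (a <= b.+1)%N ->
  size (Theta r a b z) = if z is Posz l then 'C(r * (b.+1 - a), l) else 0%N.
Proof.
move=> ab; rewrite (perm_size (Theta_subseqsZ r z ab)).
by case: z => [l|//]; rewrite /= size_subseqs size_iota.
Qed.

Lemma csum_absdet_cost A B N S : (csum_absdet A B N S).2 = size S.
Proof. by rewrite csum_cost -sum1_size; apply: eq_bigr. Qed.

(** Counts the choices in the first and last blocks, which do not depend on N. *)
Definition mixed_bound : nat := \sum_(j <- iota 1 r) \sum_(k <- iota 1 r) ('C(r, j) * 'C(r, k))%N.

(** At most n - 2 columns come from the middle blocks, which gives the power of r N. The factor
    [1 < n], read as 0 or 1, records that the sum is empty when n = 1. *)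
Lemma csum_mixed_cost A B M N : (0 < r)%N -> (2 <= M <= N)%N ->
  ((csum_mixed A B M).2 <= (1 < n) * (mixed_bound * (r * N) ^ (n - 2)))%N.
Proof.
move=> r0 /andP[M2 MN]; rewrite /csum_mixed csum_cost /mixed_bound big_distrl big_distrr.
rewrite big_seq [leqRHS]big_seq; apply: leq_sum => j; rewrite mem_iota => /andP[j1 _].
rewrite csum_cost big_distrl big_distrr.
rewrite big_seq [leqRHS]big_seq; apply: leq_sum => k; rewrite mem_iota => /andP[k1 _].
rewrite csum_absdet_cost /catprod !size_allpairs !size_Theta ?leqnSn//.
rewrite subn0 muln1 (_ : (M - 1).+1 - (M - 1) = 1)%N ?muln1; last lia.
case zE : (n%:Z - j%:Z - k%:Z) => [l|l]; last by rewrite muln0.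
have ln : (l <= n - 2)%N by lia.
(* Since j and k are at least 1, a nonnegative n - j - k forces n >= 2. *)
have -> : (1 < n)%N by lia.
rewrite /= mul1n mulnAC leq_mul2l; apply/orP; right.
apply: leq_trans (leq_bin_exp _ _) _.
apply: leq_trans (_ : (r * N) ^ l <= _)%N.
  by case: (l) => // i; rewrite leq_exp2r// leq_mul2l; apply/orP; right; lia.
by rewrite leq_pexp2l// muln_gt0 r0; lia.
Qed.

Lemma crec_cost A B v d m :
  (crec A B v d m).2 = (\sum_(i < m) (csum_mixed A B i.+2).2)%N.
Proof.
elim: m => [|m IHm]; first by rewrite big_ord0.
by rewrite big_ord_recr /= -IHm addn0.
Qed.

(** The three summands of the constant account for the volume of P_1, for det A and for the triple
    sums. *)
Lemma cvolume_cost A B N : (0 < r)%N -> (0 < n)%N -> (0 < N)%N ->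
  ((cvolume A B N).2 <= ('C(r, n) + 1 + mixed_bound * r ^ (n - 2)) * N ^ (n - 1))%N.
Proof.
move=> r0 n0; case: N => // N _.
have -> : (cvolume A B N.+1).2 = ('C(r, n) + 1 + (crec A B
    (csum_absdet A B 1 (Theta r 0 0 n)).1 (\det A) N).2)%N.
  have sT : size (Theta r 0 0 n) = 'C(r, n) by rewrite size_Theta// subn0 muln1.
  by rewrite -sT -(csum_absdet_cost A B 1) -addnA -[(crec _ _ _ _ _).2]addn0.
rewrite crec_cost mulnDl; apply: leq_add.
  by rewrite leq_pmulr// expn_gt0.
apply: leq_trans (_ : \sum_(i < N) (1 < n) * (mixed_bound * (r * N.+1) ^ (n - 2)) <= _)%N.
  by apply: leq_sum => i _; apply: csum_mixed_cost => //; rewrite /= ltnS.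
(* For n = 1 the bound N^0 leaves no room for the triple sums, and they are empty; otherwise fewer
   than N + 1 sums of order N^(n-2) are added. *)
rewrite sum_nat_const card_ord; case: leqP => [_|n1]; first by rewrite muln0.
have -> : (n - 1 = (n - 2).+1)%N by lia.
rewrite mul1n expnMn expnS -[leqRHS]mulnA [(r ^ _ * (_ * _))%N]mulnCA [leqRHS]mulnCA.
by rewrite leq_mul.
Qed.

End Reach.

Theorem corollary1 (R : realType) (n r : nat) (hn : (1 <= n)%N) (hr : (1 <= r)%N) :
  (forall (A : 'M[R]_n) (B : 'M[R]_(n, r)) (N : nat), (2 <= N)%N ->
    let V M := volume (zonotope (reach_mx A B M)) in
    (V N = (1 + `|\det A|)%:E * V (N - 1)%N - `|\det A|%:E * V (N - 2)%N
         + (\sum_(1 <= j < r.+1) \sum_(1 <= k < r.+1)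
              \sum_(s <- catprod (catprod (Theta r 0 0 j)
                                          (Theta r 1 (N - 2) (n%:Z - j%:Z - k%:Z)))
                                 (Theta r (N - 1) (N - 1) k))
                `|\det (cols_mx A B N s)|)%:E)%E)
  /\
  (exists C : nat,
    forall (A : 'M[R]_n) (B : 'M[R]_(n, r)) (N : nat), (1 <= N)%N ->
      volume (zonotope (reach_mx A B N)) = (cvolume A B N).1%:E
      /\ ((cvolume A B N).2 <= C * N ^ (n - 1))%N).
Proof.
split=> [A B N N2 V|].
  by rewrite /V !volume_reach reach_volume_rec.
exists ('C(r, n) + 1 + mixed_bound r * r ^ (n - 2))%N => A B N N1; split.
  by rewrite volume_reach cvolume_value.
exact: cvolume_cost.
Qed.
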